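(* For each positive integer $k$ and integers $q\ge 2$ let \[ g_k(q) = \min \{ |A-A| : A\subset \mathbb{Z} \text{ finite},\ kA \supset \{a+1, \ldots, a+q \} \text{ for some integer } a \}, \] and put $\beta_k = \inf_{q\geq 2} \frac{\log g_k(q)}{\log q}$. Then: (a) $\frac{2}{k} - \frac{1}{k^2} \leq \beta_k \leq \frac{2}{k}$ for all positive integers $k$; (b) the sequence $k\beta_k$ is increasing in $k$.
   Context: For a set $A$ of integers, $kA = A+\cdots+A$ ($k$ times) is the set of all sums of $k$ elements of $A$, and $A-A=\{a-b: a,b\in A\}$. *)

(* Defs.v *)
From mathcomp Require Import all_boot all_order all_algebra finmap.
From mathcomp Require Import all_classical all_reals all_analysis.

Set Implicit Arguments.
Unset Strict Implicit.
Unset Printing Implicit Defensive.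

Import Order.TTheory GRing.Theory Num.Theory.

Local Open Scope classical_set_scope.
Local Open Scope fset_scope.
Local Open Scope ring_scope.

Definition sumset (A B : {fset int}) : {fset int} :=
  [fset a + b | a in A, b in B].

Definition diffset (A B : {fset int}) : {fset int} :=
  [fset a - b | a in A, b in B].

(* With the convention 0A = {0}, so that 1A = A. *)
Definition kfold (k : nat) (A : {fset int}) : {fset int} :=
  iter k (sumset A) [fset 0].

Definition contains_interval (q : nat) (B : {fset int}) : Prop :=
  exists a : int, forall i : nat, (1 <= i <= q)%N -> a + i%:Z \in B.

Definition diff_sizes (k q : nat) : set nat :=
  [set #|` diffset A A| | A in
    [set A : {fset int} | contains_interval q (kfold k A)]].

(* The minimum of diff_sizes k q. By g_min it is attained for k > 0; the
   default value of xget only matters for k = 0. *)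
Definition g (k q : nat) : nat :=
  xget 0%N [set m | diff_sizes k q m /\
                    forall n, diff_sizes k q n -> (m <= n)%N].

(* The set is nonempty, and bounded below by 0 (ln vanishes at 0 and is nonnegative
   on positive integers), so inf is the genuine greatest lower bound. *)
Definition beta (R : realType) (k : nat) : R :=
  inf [set ln (g k q)%:R / ln q%:R | q in [set q : nat | (2 <= q)%N]].

Lemma kfold_nat_interval (k q i : nat) :
  (i <= k.+1 * q)%N ->
  i%:Z \in kfold k.+1 [fset x%:Z | x in iota 0 q.+1].
Proof.
elim: k i => [|k IH] i Hi.
  rewrite /kfold /= /sumset; apply/imfset2P; exists i%:Z.
    by apply/imfsetP; exists i => //; rewrite (mem_iota 0 q.+1) add0n ltnS -(mul1n q).
  by exists 0; rewrite ?inE ?addr0.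
pose x := minn i q.
have xq : (x <= q)%N by rewrite geq_minr.
have xi : (x <= i)%N by rewrite geq_minl.
rewrite /kfold iterS; apply/imfset2P; exists x%:Z.
  by apply/imfsetP; exists x => //; rewrite (mem_iota 0 q.+1) add0n ltnS.
exists (i - x)%N%:Z; last by rewrite -PoszD subnKC.
apply: IH; rewrite /x /minn; case: ltnP => _; first by rewrite subnn.
by rewrite leq_subLR -mulSn.
Qed.

Lemma g_min (k q : nat) : (0 < k)%N ->
  diff_sizes k q (g k q) /\
  forall n, diff_sizes k q n -> (g k q <= n)%N.
Proof.
case: k => // k _; rewrite /g; case: xgetP => [m _ []//|noP]; exfalso.
have ex : exists n, `[< diff_sizes k.+1 q n >].
  eexists; apply/asboolP; exists [fset x%:Z | x in iota 0 q.+1]; last by [].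
  exists 0 => i /andP[_ iq]; rewrite add0r; apply: kfold_nat_interval.
  by rewrite (leq_trans iq) // leq_pmull.
case: (ex_minnP ex) => m /asboolP Sm minm.
by apply: (noP m); split=> // n Sn; apply: minm; apply/asboolP.
Qed.

(* Main.v *)
(* The lower bound in (a) combines [q <= |kA| <= |A| ^ k] with the
   Plünnecke--Ruzsa inequality [|kA| |A| ^ (k-1) <= |A - A| ^ k]; the upper bound
   comes from the set of all [x * n ^ j] with [x < n] and [j < k], whose k-fold
   sums are the expansions in base [n].

   For (b) pass from [k + 1] to [k]. If [(k+1)A] contains an interval of length
   [q], digit expansions in base [q] yield sets [A_n] for intervals of length
   [q ^ n] with [|A_n - A_n| <= |A - A| ^ n]; reducing one of these modulo a prime
   [p <= q ^ n] gives [A'] with [(k+1)A' = F_p], hence [|kA'| ^ (k+1) >= p ^ k]. So the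
   k-fold sums of the box [A' ^ (k+1)] are at least [p ^ k] in number, a random
   linear map [F_p ^ (k+1) -> F_p ^ k] sends them onto at least half of [F_p ^ k],
   and [O(log p)] translates complete the covering. Reading vectors as digits in
   base [p] gives a set of integers whose k-fold sums contain an interval of
   length [p ^ k], and whose difference set is at most
   [O(log p) ^ 2 * |A - A| ^ (n(k+1))]; let [p] tend to infinity. *)
Require Import Defs.
From mathcomp Require Import all_boot all_order all_algebra all_field finmap.
From mathcomp Require Import all_classical all_reals all_analysis.
From mathcomp Require Import zify ring lra.

Set Implicit Arguments.
Unset Strict Implicit.
Unset Printing Implicit Defensive.

Import Order.TTheory GRing.Theory Num.Theory.

Local Open Scope ring_scope.

(** * Loomis--Whitney inequality *)

(** Hölder's inequality for [m + 1] functions, in integer form. By AM--GM, [x a] is at most [r]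
    times the mean over [j] of the shares [n j a / N j], and these means sum to 1 over [a]. The root
    [r] is taken in [algC]. *)
Lemma sum_le_of_pow_le_prod (I : finType) (m : nat) (c : nat) (x : I -> nat)
    (n : 'I_m.+1 -> I -> nat) :
  (forall a, (x a ^ m.+1 <= c * \prod_j n j a)%N) ->
  ((\sum_a x a) ^ m.+1 <= c * \prod_j \sum_a n j a)%N.
Proof.
move=> xn; pose N j := (\sum_a n j a)%N.
have [/existsP[j /eqP Nj0]|/existsPn N_neq0] := boolP [exists j, N j == 0%N].
  have x0 a : x a = 0%N.
    have nja0 : n j a = 0%N.
      by apply/eqP; rewrite -leqn0 -Nj0 /N (bigD1 a) //= leq_addr.
    by move: (xn a); rewrite (bigD1 j) //= nja0 mul0n muln0 leqn0 expn_eq0 => /andP[/eqP].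
  by rewrite big1 // exp0n.
pose mu a : algC := (\sum_j (n j a)%:R / (N j)%:R) / m.+1%:R.
have mu_ge0 a : 0 <= mu a.
  by rewrite divr_ge0 ?ler0n // sumr_ge0 // => j _; rewrite divr_ge0 ?ler0n.
have mu_sum : \sum_a mu a = 1.
  rewrite -mulr_suml exchange_big /=.
  under eq_bigr => j _ do rewrite -mulr_suml -natr_sum divff ?pnatr_eq0 ?N_neq0 //.
  by rewrite sumr_const card_ord divff ?pnatr_eq0.
pose Q : algC := (c * \prod_j N j)%:R; pose r := m.+1.-root Q.
have r_ge0 : 0 <= r by rewrite rootC_ge0 // ler0n.
have rQ : r ^+ m.+1 = Q by rewrite rootCK.
have x_le a : (x a)%:R <= r * mu a.
  rewrite -(@ler_pXn2r _ m.+1) ?nnegrE ?ler0n ?(mulr_ge0 r_ge0 (mu_ge0 a)) //.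
  rewrite exprMn rQ -natrX; apply: (@le_trans _ _ (c * \prod_j n j a)%:R).
    by rewrite ler_nat.
  have -> : (c * \prod_j n j a)%:R = Q * \prod_j ((n j a)%:R / (N j)%:R) :> algC.
    rewrite /Q !natrM -mulrA; congr (_ * _).
    rewrite !natr_prod -big_split /=; apply: eq_bigr => j _.
    by rewrite mulrC divfK ?pnatr_eq0 ?N_neq0.
  rewrite ler_wpM2l ?ler0n //.
  have := leif_AGM (A := predT) (E := fun j => (n j a)%:R / (N j)%:R : algC).
  rewrite card_ord => /(_ _) H; apply: (leif_le (H _)).
  by move=> j _; rewrite divr_ge0 ?ler0n.
rewrite -(ler_nat algC) -/Q -rQ natrX ler_pXn2r ?nnegrE ?ler0n //.
have -> : r = \sum_a r * mu a by rewrite -mulr_sumr mu_sum mulr1.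
by rewrite natr_sum; apply: ler_sum.
Qed.

(** Induction on the dimension, slicing along coordinate 0: each slice obeys the induction
    hypothesis and has no more points than the projection forgetting coordinate 0; Hölder then sums
    over the slices. *)
Lemma loomis_whitney (T : finType) (n : nat) (X : {set 'rV[T]_n.+2}) :
  (#|X| ^ n.+1 <= \prod_i #|[set col' i x | x in X]|)%N.
Proof.
elim: n X => [|n IH] X.
  rewrite expn1 !big_ord_recl big_ord0 muln1.
  set P := (X in (_ <= #|X| * _)%N); set P' := (X in (_ <= _ * #|X|)%N).
  rewrite -cardsX -(@card_in_imset _ _ (fun x => (col' ord0 x, col' (lift ord0 ord0) x)) X).
    apply/subset_leq_card/fintype.subsetP => _ /imsetP[x xX ->].
    by rewrite inE /= !imset_f.
  move=> x y _ _ [/rowP h0 /rowP h1]; apply/rowP => j.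
  have [->|->] : j = ord0 \/ j = lift ord0 ord0.
    by case: j => [[|[|//]] ?]; [left|right]; apply: val_inj.
  - have := h1 ord0; rewrite !mxE.
    have -> : lift (lift ord0 ord0) ord0 = ord0 :> 'I_2 by apply: val_inj.
    by [].
  - by have := h0 ord0; rewrite !mxE.
pose Xs a := [set x in X | x ord0 ord0 == a].
pose Y a := [set col' ord0 x | x in Xs a].
have YX a : #|Y a| = #|Xs a|.
  apply: card_in_imset => x y; rewrite !inE => /andP[_ /eqP xa] /andP[_ /eqP ya] /rowP h.
  apply/rowP => j; case: (unliftP ord0 j) => [i ->|->]; last by rewrite xa ya.
  by have := h i; rewrite !mxE.
have -> : #|X| = (\sum_a #|Y a|)%N.
  rewrite -sum1_card (partition_big (fun x : 'rV_ _ => x ord0 ord0) predT) //=.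
  apply: eq_bigr => a _; rewrite YX -sum1_card.
  by apply: eq_bigl => x; rewrite inE.
rewrite big_ord_recl.
pose m (j : 'I_n.+2) a := #|[set col' j x | x in Y a]|.
apply: (@leq_trans (#|[set col' ord0 x | x in X]| * \prod_(j < n.+2) \sum_a m j a)%N).
  apply: sum_le_of_pow_le_prod => a; rewrite expnS leq_mul ?IH //.
  by apply/subset_leq_card/imsetS/fintype.subsetP => x; rewrite inE => /andP[].
(* The projection forgetting coordinate [j + 1] splits according to coordinate 0, and its part over
   [a] covers the projection of the slice [Y a]. *)
rewrite leq_mul // leq_prod // => j _.
set Z := [set _ | _ in X].
rewrite -[#|Z|]sum1_card (partition_big (fun x : 'rV_ _ => x ord0 ord0) predT) //=.
apply: leq_sum => a _.
rewrite sum1_card -[#|_|]cardsE; set W := finset _.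
apply: leq_trans (leq_imset_card (col' ord0) W).
apply/subset_leq_card/fintype.subsetP => _ /imsetP[_ /imsetP[x + ->] ->].
rewrite inE => /andP[xX /eqP xa].
apply/imsetP; exists (col' (lift ord0 j) x).
  rewrite inE; apply/andP; split; first exact: imset_f.
  by rewrite mxE -xa; apply/eqP; congr (x _ _); apply: val_inj.
apply/rowP => i; rewrite !mxE; congr (x _ _); apply: val_inj => /=.
by rewrite /bump /= !add1n ltnS addnS.
Qed.

(** * Digit expansions, averaging and Cauchy--Schwarz *)

Lemma digits_inj (p n : nat) (d e : 'I_n -> nat) :
  (forall i, (d i < p)%N) -> (forall i, (e i < p)%N) ->
  (\sum_i d i * p ^ i = \sum_i e i * p ^ i)%N -> d =1 e.
Proof.
elim: n d e => [|n IH] d e dp ep; first by move=> _ [].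
have rec (f : 'I_n.+1 -> nat) :
    (\sum_i f i * p ^ i = f ord0 + (\sum_(i < n) f (lift ord0 i) * p ^ i) * p)%N.
  rewrite big_ord_recl muln1 big_distrl /=; congr addn; apply: eq_bigr => i _.
  by rewrite /bump expnS mulnA mulnAC.
have p_gt0 : (0 < p)%N by apply: leq_ltn_trans (dp ord0).
rewrite !rec => h.
have h0 : d ord0 = e ord0.
  by have := congr1 (modn^~ p) h; rewrite addnC modnMDl addnC modnMDl !modn_small.
move: h; rewrite h0 => /addnI/eqP; rewrite eqn_pmul2r // => /eqP.
move=> /(IH _ _ (fun i => dp _) (fun i => ep _)) h i.
by case: (unliftP ord0 i) => [j ->|->]; [apply: h|].
Qed.

Lemma digits_exist (p n y : nat) : (y < p ^ n)%N ->
  exists2 d : 'I_n -> nat, (forall i, (d i < p)%N) & y = (\sum_i d i * p ^ i)%N.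
Proof.
elim: n y => [|n IH] y.
  by rewrite ltnS leqn0 => /eqP ->; exists (fun=> 0%N); [case|rewrite big_ord0].
rewrite expnSr => yp.
have p_gt0 : (0 < p)%N by case: p yp {IH} => //; rewrite muln0.
have [|d dp yd] := IH (y %/ p)%N; first by rewrite ltn_divLR.
exists (fun i => if unlift ord0 i is Some j then d j else (y %% p)%N).
  by move=> i; case: unlift => [j|]; rewrite ?ltn_pmod.
rewrite big_ord_recl unlift_none muln1 {1}(divn_eq y p) addnC yd big_distrl /=.
congr addn; apply: eq_bigr => i _.
by rewrite liftK /bump expnS mulnA mulnAC.
Qed.

Lemma exists_le_average (I : finType) (i0 : I) (f : I -> nat) c :
  (\sum_i f i <= #|I| * c)%N -> exists i, (f i <= c)%N.
Proof.
move=> h; apply/existsP; apply: contraLR h; rewrite negb_exists => /forallP h.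
have : (\sum_(i : I) c.+1 <= \sum_i f i)%N by apply: leq_sum => i _; rewrite ltnNge h.
rewrite sum_nat_const mulnS -ltnNge; apply: leq_trans.
by rewrite -[X in (X < _)%N]add0n ltn_add2r; apply/card_gt0P; exists i0.
Qed.

Lemma exists_ge_average (I : finType) (i0 : I) (f : I -> nat) c :
  (#|I| * c <= \sum_i f i)%N -> exists i, (c <= f i)%N.
Proof.
move=> h; apply/existsP; apply: contraLR h; rewrite negb_exists => /forallP h.
have : (\sum_i (f i).+1 <= \sum_(i : I) c)%N.
  by apply: leq_sum => i _; rewrite ltnNge h.
rewrite sum_nat_const -ltnNge; apply: leq_trans.
under [X in (_ < X)%N]eq_bigr => i _ do rewrite -addn1.
rewrite big_split /= sum1_card -[X in (X < _)%N]addn0 ltn_add2l.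
by apply/card_gt0P; exists i0.
Qed.

Lemma sum_sq_le (I : finType) (Y : {set I}) (n : I -> nat) :
  ((\sum_(y in Y) n y) ^ 2 <= #|Y| * \sum_(y in Y) n y ^ 2)%N.
Proof.
rewrite -(leq_pmul2l (isT : 0 < 2)%N) -mulnn big_distrl /= big_distrr /=.
apply: (@leq_trans (\sum_(i in Y) \sum_(j in Y) (n i ^ 2 + n j ^ 2))%N).
  apply: leq_sum => i _; rewrite big_distrr big_distrr /=.
  by apply: leq_sum => j _; apply: nat_Cauchy.
under eq_bigr => i _ do rewrite big_split /= sum_nat_const.
by rewrite big_split /= -big_distrr sum_nat_const addnn -mul2n.
Qed.

(** * Sums and translates in a finite abelian group *)

Section FiniteSums.
Variable V : finZmodType.
Implicit Types A B : {set V}.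

Definition nsums (k : nat) A : {set V} :=
  [set \sum_i f i | f : {ffun 'I_k -> V} in ffun_on (mem A)].

Definition dset A : {set V} := [set a - b | a in A, b in A].

Lemma nsumsP k A x :
  reflect (exists2 f : 'I_k -> V, (forall i, f i \in A) & x = \sum_i f i)
          (x \in nsums k A).
Proof.
apply: (iffP imsetP) => [[f /ffun_onP fA ->]|[f fA ->]]; first by exists f.
exists [ffun i => f i]; first by apply/ffun_onP => i; rewrite ffunE.
by apply: eq_bigr => i _; rewrite ffunE.
Qed.

Lemma mem_dset A a b : a \in A -> b \in A -> a - b \in dset A.
Proof. exact: imset2_f. Qed.

(* Gyarmati--Matolcsi--Ruzsa: among the representations of each sum take the
   one of least weight; since the weight is additive in the coordinates and
   injective, deleting a coordinate keeps distinct partial sums distinct, and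
   Loomis--Whitney applies. *)
Lemma card_nsums_pow k A :
  (#|nsums k.+2 A| ^ k.+1 <= #|nsums k.+1 A| ^ k.+2)%N.
Proof.
pose w (x : 'rV[V]_k.+2) := (\sum_i enum_rank (x ord0 i) * #|V| ^ i)%N.
pose inA (x : 'rV[V]_k.+2) := [forall i, x ord0 i \in A].
pose s (x : 'rV[V]_k.+2) := \sum_i x ord0 i.
pose X := [set x | inA x & [forall y, inA y && (s y == s x) ==> (w x <= w y)%N]].
have w_inj x y : w x = w y -> x = y.
  move=> /(@digits_inj #|V| _ (fun i => enum_rank _) (fun i => enum_rank _)) h.
  by apply/rowP => i; apply/enum_rank_inj/val_inj/h.
have sX : (#|nsums k.+2 A| <= #|X|)%N.
  apply: leq_trans (leq_imset_card s X); apply/subset_leq_card/fintype.subsetP => z.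
  case/nsumsP => f fA ->.
  have P0 : inA (\row_i f i) && (s (\row_i f i) == \sum_i f i).
    apply/andP; split; first by apply/forallP => i; rewrite mxE.
    by apply/eqP/eq_bigr => i _; rewrite mxE.
  case: (arg_minnP (P := fun x => inA x && (s x == \sum_i f i)) w P0) => x /andP[xA /eqP xs] xmin.
  apply/imsetP; exists x => //; rewrite inE xA /=; apply/forallP => y.
  by apply/implyP; rewrite xs; apply: xmin.
apply: (@leq_trans (#|X| ^ k.+1)%N); first by rewrite leq_exp2r.
apply: leq_trans (loomis_whitney X) _.
rewrite -[X in (_ ^ X)%N](card_ord k.+2) -prod_nat_const.
apply: leq_prod => i _.
pose s' (x : 'rV[V]_k.+1) := \sum_i x ord0 i.
rewrite -(@card_in_imset _ _ s').
  apply/subset_leq_card/fintype.subsetP => _ /imsetP[_ /imsetP[x xX ->] ->].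
  move: xX; rewrite inE => /andP[/forallP xA _].
  by apply/nsumsP; exists (fun j => x ord0 (lift i j)) => //; apply: eq_bigr => j _; rewrite mxE.
have split_w x : w x = (enum_rank (x ord0 i) * #|V| ^ i +
    \sum_j enum_rank (x ord0 (lift i j)) * #|V| ^ (lift i j))%N.
  by rewrite /w (bigD1_ord i).
have split_s x : s x = x ord0 i + s' (col' i x).
  by rewrite /s (bigD1_ord i) //=; congr (_ + _); apply: eq_bigr => j _; rewrite mxE.
(* Exchange: [z] takes coordinate [i] from [x] and the others from [y], so it has the sum of [x] and
   cannot weigh less. Applied both ways, this makes the remaining weights of [x] and [y] equal; then
   [w x = w z], hence [x = z]. *)
have half x y : x \in X -> y \in X -> s' (col' i x) = s' (col' i y) ->
    let z := \row_j (if j == i then x ord0 i else y ord0 j) in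
    (w x <= w z)%N /\ col' i z = col' i y.
  rewrite !inE => /andP[xA /forallP xmin] /andP[yA _] e z.
  have zy : col' i z = col' i y.
    by apply/rowP => j; rewrite !mxE eq_sym (negPf (neq_lift _ _)).
  split=> //; apply: (implyP (xmin z)).
  apply/andP; split; last by rewrite !split_s zy -e mxE !eqxx.
  by apply/forallP => j; rewrite mxE; case: eqP => _; [apply: (forallP xA)|apply: (forallP yA)].
have le_part x y : x \in X -> y \in X -> s' (col' i x) = s' (col' i y) ->
    (\sum_j enum_rank (x ord0 (lift i j)) * #|V| ^ (lift i j) <=
     \sum_j enum_rank (y ord0 (lift i j)) * #|V| ^ (lift i j))%N.
  move=> xX yX e; case: (half x y xX yX e); rewrite !split_w mxE eqxx leq_add2l.
  move=> h _; apply: leq_trans h _; apply: eq_leq; apply: eq_bigr => j _.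
  by rewrite mxE eq_sym (negPf (neq_lift _ _)).
move=> _ _ /imsetP[x xX ->] /imsetP[y yX ->] e.
have [_ <-] := half x y xX yX e; congr (col' i _); apply: w_inj.
rewrite !split_w mxE eqxx; congr addn; apply/eqP; rewrite eqn_leq.
under [X in _ && (X <= _)%N]eq_bigr => j _ do
  rewrite mxE eq_sym (negPf (neq_lift _ _)).
under [X in (_ <= X)%N && _]eq_bigr => j _ do
  rewrite mxE eq_sym (negPf (neq_lift _ _)).
by rewrite !le_part.
Qed.

(** Double counting: the average over [u] of the size of [U] intersected with [P + u] is
    [#|U| * #|P| / #|V|], at least half of [#|U|]. *)
Lemma exists_translate (P U : {set V}) : (#|V| <= 2 * #|P|)%N ->
  exists u, (#|U| <= 2 * #|[set v in U | (v - u)%R \in P]|)%N.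
Proof.
move=> VP.
have sum_eq : (\sum_u #|[set v in U | (v - u)%R \in P]| = #|U| * #|P|)%N.
  under eq_bigr => u _ do rewrite -sum1_card big_mkcond /=.
  rewrite exchange_big /=.
  under eq_bigr => v _ do under eq_bigr => u _ do rewrite inE.
  rewrite -sum_nat_const [RHS]big_mkcond /=; apply: eq_bigr => v _.
  case: (v \in U); last by rewrite big1.
  rewrite -big_mkcond (eq_bigl (fun t => t \in [set t | v - t \in P])) => [|t]; last by rewrite inE.
  rewrite sum1_card -(card_imset _ (subrI v)).
  apply: eq_card => u; apply/imsetP/idP => [[t tP ->]|uP].
    by move: tP; rewrite inE.
  by exists (v - u); rewrite ?inE subKr.
apply: (exists_ge_average 0); rewrite -big_distrr /= sum_eq mulnCA mulnC.
by rewrite leq_mul2l VP orbT.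
Qed.

(** Greedy choice: each new translate of [P] at least halves the uncovered set, so after [t] steps
    fewer than one element is left. *)
Lemma exists_translates_cover (P : {set V}) t :
  (#|V| <= 2 * #|P|)%N -> (#|V| < 2 ^ t)%N ->
  exists2 T : {set V}, (#|T| <= t)%N & forall v, exists2 u, u \in T & v - u \in P.
Proof.
move=> VP Vt.
have [T Tt TU] : exists2 T : {set V}, (#|T| <= t)%N &
    (2 ^ t * #|[set v | [forall u in T, (v - u)%R \notin P]]| <= #|V|)%N.
  elim: t {Vt} => [|t [T Tt TU]].
    by exists finset.set0; rewrite ?cards0 // mul1n max_card.
  set U := finset _ in TU; have [u uU] := exists_translate U VP.
  exists (u |: T); first by rewrite cardsU1 -add1n leq_add ?leq_b1.
  apply: leq_trans TU; rewrite expnSr -mulnA leq_mul2l.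
  rewrite -(cardsID [set v | (v - u)%R \in P] U) in uU *.
  have -> : U :&: [set v | (v - u)%R \in P] = [set v in U | (v - u)%R \in P].
    by apply/finset.setP => v; rewrite !inE.
  set W := finset _; have -> : #|W| = #|U :\: [set v | (v - u)%R \in P]|.
    apply: eq_card => v; rewrite !inE; apply/forall_inP/andP.
      move=> h; split; first by apply: h; rewrite !inE eqxx.
      by apply/forall_inP => z zT; apply: h; rewrite !inE zT orbT.
    by move=> [vu /forall_inP h] z; rewrite !inE => /orP[/eqP -> //|]; apply: h.
  rewrite mul2n -addnn leq_add2r.
  move: uU; rewrite mul2n -addnn.
  have -> : U :&: [set v | (v - u)%R \in P] = [set v in U | (v - u)%R \in P].
    by apply/finset.setP => v; rewrite !inE.
  by rewrite leq_add2l => ->; rewrite orbT.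
exists T => // v; apply/exists_inP; apply: contraLR Vt.
rewrite negb_exists_in -leqNgt => h; apply: leq_trans TU.
by rewrite leq_pmulr //; apply/card_gt0P; exists v; rewrite inE.
Qed.

End FiniteSums.

(** * Dense images under random linear maps *)

Section DenseImage.
Variable F : finFieldType.

(** For a column [c] with [d *m c = 1], the map sending [(M, y)] to [M + c *m y] is injective on
    pairs with [d *m M = 0]: multiplying by [d] recovers [y]. *)
Lemma card_ker_mulmx m k (d : 'rV[F]_m) : d != 0 ->
  (#|[set M : 'M[F]_(m, k) | d *m M == 0%R]| * #|F| ^ k <= #|F| ^ (m * k))%N.
Proof.
move=> d0; have [i di] : exists i, d ord0 i != 0.
  apply/existsP; apply: contraNT d0; rewrite negb_exists => /forallP h.
  by apply/eqP/rowP => i; rewrite mxE; apply/eqP; rewrite -[_ == _]negbK h.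
pose c : 'cV[F]_m := (d ord0 i)^-1 *: delta_mx i ord0.
have dc : d *m c = 1%:M.
  rewrite -scalemxAr; apply/matrixP => x y; rewrite !ord1 !mxE (bigD1 i) //=.
  rewrite !mxE !eqxx /= mulr1 big1 ?addr0 ?mulVf // => j /negPf ji.
  by rewrite mxE ji mulr0.
have -> : (#|F| ^ k)%N = #|[set: 'rV[F]_k]| by rewrite cardsT card_mx mul1n.
rewrite -card_mx -cardsX.
rewrite -(@card_in_imset _ _ (fun My => My.1 + c *m My.2)) ?max_card //.
move=> [M y] [M' y']; rewrite !inE /= !andbT => /eqP dM /eqP dM' e.
have ey : y = y'.
  have := congr1 (mulmx d) e.
  by rewrite !mulmxDr dM dM' !add0r !mulmxA dc !mul1mx.
by move: e; rewrite ey => /addIr ->.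
Qed.

(* Second moment over a random matrix. *)
Lemma exists_dense_image m k (S : {set 'rV[F]_m}) : (#|F| ^ k <= #|S|)%N ->
  exists M : 'M[F]_(m, k), (#|F| ^ k <= 2 * #|[set x *m M | x in S]|)%N.
Proof.
move=> FS.
have F_gt0 : (0 < #|F| ^ k)%N by rewrite expn_gt0; apply/orP; left; apply/card_gt0P; exists 0.
have S_gt0 : (0 < #|S|)%N by apply: leq_trans FS.
pose N (M : 'M[F]_(m, k)) y := #|[set x in S | x *m M == y]|.
(* [coll M] counts the ordered pairs in [S] with equal image; by Cauchy--Schwarz few collisions
   force a large image. *)
pose coll (M : 'M[F]_(m, k)) := (\sum_(x in S) N M (x *m M))%N.
have cs M : (#|S| ^ 2 <= #|[set x *m M | x in S]| * coll M)%N.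
  have e : #|S| = (\sum_(y in [set x *m M | x in S]) N M y)%N.
    rewrite -sum1_card (partition_big_imset (fun x => x *m M)) /=.
    by apply: eq_bigr => y _; rewrite /N -sum1_card; apply: eq_bigl => x; rewrite inE.
  rewrite {1}e; apply: leq_trans (sum_sq_le _ _) _; rewrite leq_mul2l; apply/orP; right.
  rewrite /coll (partition_big_imset (fun x => x *m M)) /=; apply: leq_sum => y _.
  rewrite (eq_bigr (fun=> N M y)) => [|x /andP[_ /eqP -> //]].
  rewrite sum_nat_const -mulnn leq_mul2r; apply/orP; right.
  by apply/subset_leq_card/fintype.subsetP => x; rewrite inE.
(* For fixed [x], the pair [(x, x)] always collides, while a pair [(x, z)] with [z != x] collides
   for at most a proportion [1 / #|F| ^ k] of the matrices. Since [#|F| ^ k <= #|S|], each kind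
   accounts for one of the two copies of [#|S|]. *)
have total : (\sum_M #|F| ^ k * coll M <= #|{: 'M[F]_(m, k)}| * (2 * #|S| ^ 2))%N.
  rewrite -big_distrr exchange_big /= big_distrr /=.
  have bound x : x \in S ->
      (#|F| ^ k * \sum_M N M (x *m M) <= #|F| ^ (m * k) * (2 * #|S|))%N.
    move=> xS.
    have -> : (\sum_M N M (x *m M) =
        \sum_(z in S) #|[set M : 'M[F]_(m, k) | (z - x) *m M == 0%R]|)%N.
      under eq_bigr => M _ do rewrite /N -sum1_card big_mkcond /=.
      rewrite exchange_big /= [RHS]big_mkcond /=; apply: eq_bigr => z _.
      case: ifP => zS.
        rewrite -sum1_card [RHS]big_mkcond /=; apply: eq_bigr => M _.
        by rewrite !inE zS mulmxBl subr_eq0.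
      by rewrite big1 // => M _; rewrite inE zS.
    rewrite (bigD1 x) //= subrr mulnDr mul2n -addnn mulnDr.
    apply: leq_add.
      rewrite mulnC leq_mul //.
      by apply: leq_trans (max_card _) _; rewrite card_mx.
    rewrite big_distrr /= mulnC; apply: (@leq_trans (\sum_(z in S) #|F| ^ (m * k))%N).
      rewrite [leqRHS](bigD1 x) //=; apply: leq_trans (leq_addl _ _).
      apply: leq_sum => z /andP[_ zx].
      by rewrite mulnC card_ker_mulmx // subr_eq0.
    by rewrite sum_nat_const.
  apply: (@leq_trans (\sum_(x in S) #|F| ^ (m * k) * (2 * #|S|))%N); first exact: leq_sum.
  by rewrite sum_nat_const card_mx mulnCA leq_mul2l mulnCA mulnn leqnn orbT.
have [M collM] := exists_le_average 0 total.
exists M; have S2_gt0 : (0 < #|S| ^ 2)%N by rewrite expn_gt0 S_gt0.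
rewrite -(leq_pmul2r S2_gt0).
apply: (@leq_trans (#|F| ^ k * (#|[set x *m M | x in S]| * coll M))%N).
  by rewrite leq_mul2l cs orbT.
by rewrite mulnCA -mulnA [leqRHS]mulnCA leq_mul2l collM orbT.
Qed.

End DenseImage.

(** * Boxes, and covering sets in one dimension less *)

Lemma dset_imset (U V : finZmodType) (f : {additive U -> V}) (A : {set U}) :
  dset [set f x | x in A] = [set f x | x in dset A].
Proof.
apply/finset.setP => v; apply/imset2P/imsetP.
  move=> [_ _ /imsetP[x xA ->] /imsetP[y yA ->] ->].
  by exists (x - y); rewrite ?mem_dset ?raddfB.
move=> [_ /imset2P[x y xA yA ->] ->].
by exists (f x) (f y); rewrite ?imset_f ?raddfB.
Qed.

Lemma nsums_imset (U V : finZmodType) (f : {additive U -> V}) k (A : {set U}) :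
  nsums k [set f x | x in A] = [set f x | x in nsums k A].
Proof.
apply/finset.setP => v; apply/nsumsP/imsetP.
  move=> [h hA ->].
  have [h' h'A] : exists2 h' : 'I_k -> U, (forall i, h' i \in A) & forall i, h i = f (h' i).
    have ex i : exists x, (x \in A) && (h i == f x).
      by case/imsetP: (hA i) => x xA ->; exists x; rewrite xA /=.
    exists (fun i => xchoose (ex i)) => i; by case/andP: (xchooseP (ex i)) => // _ /eqP.
  move=> hh'; exists (\sum_i h' i); first by apply/nsumsP; exists h'.
  by rewrite raddf_sum; apply: eq_bigr.
move=> [_ /nsumsP[h hA ->] ->]; exists (fun i => f (h i)); last by rewrite raddf_sum.
by move=> i; apply: imset_f.
Qed.

Definition box (T : finType) n (A : {set T}) : {set 'rV[T]_n} :=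
  [set x : 'rV[T]_n | [forall i, x ord0 i \in A]].

Lemma card_box (T : finType) n (A : {set T}) : #|box n A| = (#|A| ^ n)%N.
Proof.
have <- : #|(ffun_on (mem A) : {pred {ffun 'I_n -> T}})| = (#|A| ^ n)%N.
  by rewrite card_ffun_on card_ord.
have inj : injective (fun f : {ffun 'I_n -> T} => \row_i f i).
  by move=> f f' /rowP e; apply/ffunP => i; move: (e i); rewrite !mxE.
rewrite -(card_imset _ inj); apply: eq_card => x; rewrite inE.
apply/forallP/imsetP => [xA|[f /ffun_onP fA -> i]]; last by rewrite mxE.
exists [ffun i => x ord0 i]; first by apply/ffun_onP => i; rewrite ffunE.
by apply/rowP => i; rewrite mxE ffunE.
Qed.

Lemma dset_box (V : finZmodType) n (A : {set V}) :
  dset (box n A) \subset box n (dset A).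
Proof.
apply/fintype.subsetP => _ /imset2P[x y + + ->]; rewrite !inE => /forallP xA /forallP yA.
by apply/forallP => i; rewrite !mxE mem_dset.
Qed.

Lemma nsums_box (V : finZmodType) k n (A : {set V}) :
  box n (nsums k A) \subset nsums k (box n A).
Proof.
apply/fintype.subsetP => x; rewrite inE => /forallP xA.
have ex i : exists f : {ffun 'I_k -> V}, (f \in ffun_on (mem A)) && (x ord0 i == \sum_j f j).
  by case/imsetP: (xA i) => f fA ->; exists f; rewrite fA /=.
pose f i := xchoose (ex i).
have fP i : (forall j, f i j \in A) /\ x ord0 i = \sum_j f i j.
  by case/andP: (xchooseP (ex i)) => /ffun_onP ? /eqP.
apply/nsumsP; exists (fun j => \row_i f i j).
  by move=> j; rewrite inE; apply/forallP => i; rewrite mxE; case: (fP i).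
apply/rowP => i; rewrite summxE; case: (fP i) => _ ->.
by apply: eq_bigr => j _; rewrite mxE.
Qed.

Lemma covering_set_in_smaller_dimension (F : finFieldType) k t (A : {set F}) :
  nsums k.+2 A = [set: F] -> (#|F| ^ k.+1 < 2 ^ t)%N ->
  exists2 B : {set 'rV[F]_k.+1}, nsums k.+1 B = [set: 'rV[F]_k.+1] &
    (#|dset B| <= t.+1 ^ 2 * #|dset A| ^ k.+2)%N.
Proof.
move=> AF Ft.
have [M dense] : exists M : 'M[F]_(k.+2, k.+1),
    (#|F| ^ k.+1 <= 2 * #|[set x *m M | x in box k.+2 (nsums k.+1 A)]|)%N.
  apply: exists_dense_image; rewrite card_box.
  by apply: leq_trans (card_nsums_pow k A); rewrite AF cardsT.
pose f : {additive 'rV[F]_k.+2 -> 'rV[F]_k.+1} := mulmxr M.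
pose C := [set f x | x in box k.+2 A].
have dense' : (#|{: 'rV[F]_k.+1}| <= 2 * #|nsums k.+1 C|)%N.
  rewrite card_mx mul1n; apply: leq_trans dense _; rewrite leq_mul2l /=.
  by rewrite nsums_imset; apply/subset_leq_card/imsetS/nsums_box.
have [|T Tt cover] := exists_translates_cover dense' (t := t).
  by rewrite card_mx mul1n.
(* Adjoining 0 lets a sum use a translate in its summand [ord0] only and 0 in the others. It also
   turns [t] into [t.+1], and differences of [T0] contribute the square. *)
pose T0 := 0 |: T.
exists [set c + u | c in C, u in T0].
  apply/finset.setP => v; rewrite inE; have [u uT /nsumsP[h hC vu]] := cover v.
  apply/nsumsP; exists (fun i => h i + if i == ord0 then u else 0).
    move=> i; apply: imset2_f => //; case: ifP => _; by rewrite !inE ?eqxx ?uT ?orbT.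
  rewrite big_split /= -vu -big_mkcond big_pred1_eq subrK //.
apply: (@leq_trans #|[set x + y | x in [set u.1 - u.2 | u in finset.setX T0 T0], y in dset C]|).
  apply/subset_leq_card/fintype.subsetP => _
    /imset2P[_ _ /imset2P[c u cC uT ->] /imset2P[c' u' c'C u'T ->] ->].
  apply/imset2P; exists (u - u') (c - c'); rewrite ?mem_dset //.
    by apply/imsetP; exists (u, u'); rewrite // inE uT.
  by rewrite opprD addrACA addrC.
rewrite curry_imset2X; apply: leq_trans (leq_imset_card _ _) _.
rewrite cardsX leq_mul //.
  apply: leq_trans (leq_imset_card _ _) _; rewrite cardsX -mulnn.
  by apply: leq_mul; rewrite cardsU1; apply: leq_add (leq_b1 _) Tt.
rewrite dset_imset; apply: leq_trans (leq_imset_card _ _) _.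
by apply: leq_trans (subset_leq_card (dset_box _ _)) _; rewrite card_box.
Qed.

(** * Sumsets and intervals in the integers *)

Lemma card_fset_le (K : choiceType) (A : {fset K}) (s : seq K) :
  {subset A <= s} -> (#|` A| <= size s)%N.
Proof. exact/uniq_leq_size/fset_uniq. Qed.

Lemma sumsetP (A B : {fset int}) x :
  reflect (exists a b, [/\ a \in A, b \in B & x = a + b]) (x \in sumset A B).
Proof.
apply: (iffP (imfset2P _ _ _ _ _)) => [[a aA [b bB ->]]|[a [b [aA bB ->]]]].
  by exists a, b.
by exists a => //; exists b.
Qed.

Lemma diffsetP (A B : {fset int}) x :
  reflect (exists a b, [/\ a \in A, b \in B & x = a - b]) (x \in diffset A B).
Proof.
apply: (iffP (imfset2P _ _ _ _ _)) => [[a aA [b bB ->]]|[a [b [aA bB ->]]]].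
  by exists a, b.
by exists a => //; exists b.
Qed.

Lemma kfoldP k (A : {fset int}) x :
  reflect (exists2 f : 'I_k -> int, (forall i, f i \in A) & x = \sum_i f i)
          (x \in kfold k A).
Proof.
elim: k x => [|k IH] x.
  rewrite inE; apply: (iffP eqP) => [->|[f _ ->]]; last by rewrite big_ord0.
  by exists (fun=> 0); [case|rewrite big_ord0].
apply: (iffP (sumsetP _ _ _)) => [[a [y [aA /IH[f fA ->] ->]]]|[f fA ->]].
  exists (fun i => if unlift ord0 i is Some j then f j else a).
    by move=> i; case: unlift.
  rewrite big_ord_recl unlift_none; congr (_ + _).
  by apply: eq_bigr => j _; rewrite liftK.
exists (f ord0), (\sum_i f (lift ord0 i)); rewrite big_ord_recl; split=> //.
by apply/IH; exists (fun i => f (lift ord0 i)).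
Qed.

Lemma card_sumset_le (A B : {fset int}) : (#|` sumset A B| <= #|` A| * #|` B|)%N.
Proof.
rewrite -(size_allpairs (fun a b => a + b)); apply: card_fset_le => x /sumsetP[a [b [aA bB ->]]].
exact: allpairs_f.
Qed.

Lemma card_diffset_le (A B : {fset int}) : (#|` diffset A B| <= #|` A| * #|` B|)%N.
Proof.
rewrite -(size_allpairs (fun a b => a - b)); apply: card_fset_le => x /diffsetP[a [b [aA bB ->]]].
exact: allpairs_f.
Qed.

Lemma card_kfold_le k (A : {fset int}) : (#|` kfold k A| <= #|` A| ^ k)%N.
Proof.
elim: k => [|k IH]; first by rewrite cardfs1.
by apply: leq_trans (card_sumset_le _ _) _; rewrite expnS leq_mul2l IH orbT.
Qed.

Lemma contains_interval_card q B : contains_interval q B -> (q <= #|` B|)%N.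
Proof.
move=> [a aB]; rewrite -(size_iota 1 q) -(size_map (fun i : nat => a + i%:Z)).
apply: uniq_leq_size => [|_ /mapP[i + ->]]; last by rewrite mem_iota => h; apply: aB; lia.
by rewrite map_inj_uniq ?iota_uniq // => i j /addrI[].
Qed.

(** Each step adjoins a digit, forming [x + q * y] with [x] in [A] and [y] in [An]. This form is
    linear in [(x, y)], so sums and differences are computed digit by digit. *)
Lemma contains_interval_pow l q n (A : {fset int}) :
  contains_interval q (kfold l A) ->
  exists2 An : {fset int}, contains_interval (q ^ n) (kfold l An) &
    (#|` diffset An An| <= #|` diffset A A| ^ n)%N.
Proof.
move=> [a aA]; elim: n => [|n [An [b bAn] cardAn]].
  exists [fset 0]%fset; last first.
    by apply: leq_trans (card_diffset_le _ _) _; rewrite cardfs1.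
  exists (- 1) => i i1; have -> : i = 1%N by move: i1; rewrite expn0; lia.
  by apply/kfoldP; exists (fun=> 0); rewrite ?inE // big1.
exists [fset (x + q%:Z * y)%R | x in A, y in An]%fset.
  (* Both given intervals start one past [a] and [b]. Writing [i - 1 = u * q + v], the digits
     [v + 1] and [u + 1] give [(a + v + 1) + q * (b + u + 1)], whence the extra [q] in the
     offset. *)
  exists (a + q%:Z * b + q%:Z) => i iq.
  have q_gt0 : (0 < q)%N by case: q iq {aA bAn} => // ; rewrite exp0n //; lia.
  have iq' : (i.-1 %/ q < q ^ n)%N by rewrite ltn_divLR // -expnSr; lia.
  have /kfoldP[f fA ef] := aA (i.-1 %% q).+1 (ltn_pmod i.-1 q_gt0).
  have /kfoldP[h hA eh] := bAn (i.-1 %/ q).+1 iq'.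
  apply/kfoldP; exists (fun j => f j + q%:Z * h j).
    by move=> j; apply/imfset2P; exists (f j) => //; exists (h j).
  rewrite big_split -mulr_sumr -ef -eh.
  have := divn_eq i.-1 q; have : (0 < i)%N by lia.
  move: (_ %/ _)%N (_ %% _)%N => u v i0 e.
  have -> : i = (u * q + v).+1 by lia.
  by rewrite !intS PoszD PoszM /=; ring.
rewrite expnS; apply: leq_trans (leq_mul (leqnn _) cardAn).
rewrite -(size_allpairs (fun a b => a + q%:Z * b)); apply: card_fset_le => _
  /diffsetP[_ [_ [/imfset2P[x xA [y yA ->]] /imfset2P[x' x'A [y' y'A ->]] ->]]].
have -> : x + q%:Z * y - (x' + q%:Z * y') = x - x' + q%:Z * (y - y') by ring.
by apply: allpairs_f; apply/diffsetP; [exists x, x'|exists y, y'].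
Qed.

(** * Reduction modulo a prime *)

Definition modp (p : nat) (A : {fset int}) : {set 'F_p} :=
  [set x in [seq a%:~R | a <- A]].

Lemma nsums_modp p m l (A : {fset int}) : prime p -> (p <= m)%N ->
  contains_interval m (kfold l A) -> nsums l (modp p A) = [set: 'F_p].
Proof.
move=> p_prime pm [a aA]; apply/finset.setP => y; rewrite inE.
pose i := val (y - (a + 1)%:~R).
have ip : (i < p)%N by rewrite -[X in (_ < X)%N](Fp_cast p_prime) ltn_ord.
have /kfoldP[f fA ef] := aA i.+1 (leq_trans ip pm).
apply/nsumsP; exists (fun j => (f j)%:~R).
  by move=> j; rewrite inE map_f.
rewrite -rmorph_sum -ef intS addrA /= intrD.
have -> : (i%:Z)%:~R = y - (a + 1)%:~R by apply: natr_Zp.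
by rewrite [RHS]addrC subrK.
Qed.

Lemma dset_modp p (A : {fset int}) : (#|dset (modp p A)| <= #|` diffset A A|)%N.
Proof.
rewrite cardE -(size_map (fun x : int => x%:~R : 'F_p)).
apply: uniq_leq_size (enum_uniq _) _ => x; rewrite mem_enum => /imset2P[y z].
rewrite !inE => /mapP[a aA ->] /mapP[b bA ->] ->.
by rewrite -intrB map_f //; apply/diffsetP; exists a, b.
Qed.

(** * Plünnecke--Ruzsa inequality *)

(* Petridis: the hypothesis says that [X] minimises the ratio |Z + B| / |Z|. *)
Lemma petridis (X B C : {fset int}) :
  (forall Z : {fset int}, {subset Z <= X} ->
     (#|` sumset X B| * #|` Z| <= #|` sumset Z B| * #|` X|)%N) ->
  (#|` sumset C (sumset X B)| * #|` X| <= #|` sumset X B| * #|` sumset C X|)%N.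
Proof.
move=> Xmin; pose Cs (s : seq int) := [fset c in s]%fset.
have -> : C = Cs (enum_fset C) by apply/fsetP => x; rewrite !inE.
elim: (enum_fset C) => [|c s IH].
  rewrite (_ : sumset _ (sumset X B) = fset0) ?cardfs0 //.
  by apply/fsetP => x; rewrite inE; apply/sumsetP => -[a [b []]]; rewrite inE.
set T := sumset X B in IH Xmin *.
set U := sumset (Cs s) T in IH; set W := sumset (Cs s) X in IH.
(* [Z] consists of the [z] for which [c + z + B] already lies in [U]. Adding [c] enlarges [U] by at
   most [|T| - |Z + B|] and [W] by at least [|X| - |Z|]; minimality of [X] against [Z] compares the
   two. *)
pose Z := [fset z in X | all (fun b => (c + z + b)%R \in U) B]%fset.
have ZX : {subset Z <= X} by move=> z; rewrite !inE => /andP[].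
have ZT : (sumset Z B `<=` T)%fset.
  apply/fsubsetP => _ /sumsetP[z [b [/ZX zX bB ->]]].
  by apply/sumsetP; exists z, b.
have cardU : (#|` sumset (Cs (c :: s)) T| + #|` sumset Z B| <= #|` U| + #|` T|)%N.
  have := cardfsD T (sumset Z B); rewrite (fsetIidPr ZT) => e.
  have := fsubset_leq_card ZT.
  suff : (#|` sumset (Cs (c :: s)) T| <= #|` U| + #|` (T `\` sumset Z B)%fset|)%N by lia.
  rewrite -(size_map (fun y => c + y) (T `\` sumset Z B)%fset) -size_cat.
  apply: card_fset_le => _ /sumsetP[d [t [dC tT ->]]]; rewrite mem_cat.
  have [|tU] := boolP (d + t \in U) => //=.
  move: dC; rewrite !inE => /orP[/eqP dc|ds]; last first.
    by case/negP: tU; apply/sumsetP; exists d, t; rewrite !inE.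
  rewrite dc in tU *; apply: map_f; rewrite !inE tT andbT.
  apply/sumsetP => -[z [b [+ bB te]]]; rewrite !inE => /andP[_ /allP/(_ b bB)].
  by rewrite -addrA -te => /negPn; rewrite tU.
have cardW : (#|` W| + #|` X| <= #|` sumset (Cs (c :: s)) X| + #|` Z|)%N.
  have ZX' : (Z `<=` X)%fset by apply/fsubsetP.
  have := cardfsD X Z; rewrite (fsetIidPr ZX') => e.
  have := fsubset_leq_card ZX'.
  suff : (#|` W| + #|` (X `\` Z)%fset| <= #|` sumset (Cs (c :: s)) X|)%N by lia.
  rewrite -(size_map (fun y => c + y) (X `\` Z)%fset) -size_cat.
  apply: uniq_leq_size.
    rewrite cat_uniq fset_uniq map_inj_uniq ?fset_uniq ?andbT; last exact: addrI.
    apply/hasPn => _ /mapP[x + ->]; rewrite !inE => /andP[+ xX]; rewrite xX /=.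
    apply: contra => /sumsetP[d [y [ds yX e']]]; apply/allP => b bB.
    apply/sumsetP; exists d, (y + b); split=> //; last by rewrite addrA e'.
    by apply/sumsetP; exists y, b.
  move=> x; rewrite mem_cat => /orP[/sumsetP[d [y [ds yX ->]]]|/mapP[y + ->]].
    by apply/sumsetP; exists d, y; rewrite !inE in ds *; rewrite ds orbT.
  rewrite !inE => /andP[_ yX].
  by apply/sumsetP; exists c, y; rewrite !inE eqxx.
have := Xmin Z ZX; move: cardU cardW IH.
by move: #|` _| #|` _| #|` _| #|` _| #|` _| #|` _| #|` _|; nia.
Qed.

(** The comparison runs over subsets of [A], not just of [X]: subsets of [X] feed Petridis' lemma,
    and [Z = A] bounds the minimal ratio. *)
Lemma exists_ratio_minimiser (A B : {fset int}) : A != fset0 ->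
  exists2 X : {fset int}, (X `<=` A)%fset && (X != fset0) &
    forall Z : {fset int}, {subset Z <= A} ->
      (#|` sumset X B| * #|` Z| <= #|` sumset Z B| * #|` X|)%N.
Proof.
move=> A0; pose P (X : fpowerset A) := val X != fset0.
pose r (X : fpowerset A) : rat := #|` sumset (val X) B|%:R / #|` val X|%:R.
have AA : A \in fpowerset A by rewrite fpowersetE.
case: (arg_minP (i0 := [` AA]%fset) (P := P) r A0) => X PX Xmin.
exists (val X); first by rewrite -fpowersetE (valP X).
move=> Z ZA; have [->|Z0] := eqVneq Z fset0; first by rewrite cardfs0 muln0.
have ZA' : Z \in fpowerset A by rewrite fpowersetE; apply/fsubsetP.
have := Xmin [` ZA']%fset Z0; rewrite /r /=.
rewrite ler_pdivrMr ?ltr0n ?cardfs_gt0 // mulrAC ler_pdivlMr ?ltr0n ?cardfs_gt0 //.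
by rewrite -!natrM ler_nat.
Qed.

Lemma kfold_opp k (A : {fset int}) :
  (#|` kfold k A| <= #|` kfold k [fset (- a)%R | a in A]%fset|)%N.
Proof.
rewrite -(size_map -%R (kfold k [fset (- a)%R | a in A]%fset)).
apply: card_fset_le => _ /kfoldP[f fA ->].
rewrite -[\sum_i f i]opprK map_f //; apply/kfoldP; exists (fun i => - f i).
  by move=> i; apply/imfsetP; exists (f i).
by rewrite sumrN.
Qed.

(** With [B = -A] and a minimiser [X], iterating Petridis' lemma multiplies the size of [kB + X] by
    at most [|X + B| / |X|] per step, a ratio at most [|A - A| / |A|]. Up to sign and translation,
    [kA] embeds in [kB + X]. A factor [|A|] on both sides avoids the exponent [k - 1]. *)
Lemma plunnecke_ruzsa k (A : {fset int}) : A != fset0 ->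
  (#|` kfold k A| * #|` A| ^ k <= #|` diffset A A| ^ k * #|` A|)%N.
Proof.
move=> A0; pose B := [fset (- a)%R | a in A]%fset.
have AB : sumset A B = diffset A A.
  apply/fsetP => x; apply/sumsetP/diffsetP => [[a [_ [aA /imfsetP[b bA ->] ->]]]|].
    by exists a, b.
  move=> [a [b [aA bA ->]]]; exists a, (- b); split=> //; by apply/imfsetP; exists b.
have [X /andP[XA X0] Xmin] := exists_ratio_minimiser B A0.
have iter_le : (#|` sumset (kfold k B) X| * #|` X| ^ k <= #|` sumset X B| ^ k * #|` X|)%N.
  elim: k => [|k IH].
    rewrite !muln1 mul1n; apply: leq_trans (card_sumset_le _ _) _.
    by rewrite cardfs1 mul1n.
  have := @petridis X B (kfold k B) (fun Z ZX => Xmin Z (fun z zZ => fsubsetP XA z (ZX z zZ))).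
  have -> : sumset (kfold k B) (sumset X B) = sumset (kfold k.+1 B) X.
    apply/fsetP => x; apply/sumsetP/sumsetP.
      move=> [c [_ [cB /sumsetP[y [b [yX bB ->]]] ->]]].
      exists (b + c), y; split=> //; first by apply/sumsetP; exists b, c.
      by rewrite addrCA addrC (addrC c).
    move=> [_ [y [/sumsetP[b [c [bB cB ->]]] yX ->]]].
    exists c, (y + b); split=> //; first by apply/sumsetP; exists y, b.
    by rewrite addrCA addrC (addrC c).
  move=> h; rewrite !expnS mulnA.
  apply: leq_trans (leq_mul h (leqnn _)) _.
  by rewrite -!mulnA leq_mul2l IH orbT.
have X_gt0 : (0 < #|` X|)%N by rewrite cardfs_gt0.
have kX : (#|` kfold k A| <= #|` sumset (kfold k B) X|)%N.
  apply: leq_trans (kfold_opp k A) _.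
  have [x xX] := fset0Pn _ X0; rewrite -(size_map (fun y => y - x) (sumset (kfold k B) X)).
  apply: card_fset_le => y yB; apply/mapP; exists (y + x); last by rewrite addrK.
  by apply/sumsetP; exists y, x.
have ratio : (#|` sumset X B| * #|` A| <= #|` diffset A A| * #|` X|)%N.
  by rewrite -AB; apply: Xmin.
have Xk_gt0 : (0 < #|` X| ^ k)%N by rewrite expn_gt0 X_gt0.
rewrite -(leq_pmul2r Xk_gt0) mulnAC.
apply: leq_trans (leq_mul (leq_mul kX (leqnn _)) (leqnn _)) _.
apply: leq_trans (leq_mul iter_le (leqnn _)) _.
rewrite mulnAC -expnMn.
apply: leq_trans (leq_mul (_ : _ <= (#|` diffset A A| * #|` X|) ^ k)%N (leqnn _)) _.
  by case: k {iter_le kX Xk_gt0} => // k; rewrite leq_exp2r.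
by rewrite expnMn mulnAC leq_mul // leq_mul // fsubset_leq_card.
Qed.

(** * Lower and upper bounds for [g] *)

(** Raise [q * |A| ^ (k - 1) <= |A - A| ^ k] to the power [k] and use [q <= |A| ^ k] once more: the
    power of [q] becomes [k + (k - 1)]. *)
Lemma pow_le_diffset k q (A : {fset int}) : (0 < k)%N -> (0 < q)%N ->
  contains_interval q (kfold k A) ->
  (q ^ (2 * k - 1) <= #|` diffset A A| ^ (k ^ 2))%N.
Proof.
move=> k_gt0 q_gt0 /contains_interval_card qk.
have qA := leq_trans qk (card_kfold_le k A).
have A_gt0 : (0 < #|` A|)%N by have := leq_trans q_gt0 qA; rewrite expn_gt0 => /orP[//|/eqP]; lia.
have : (q * #|` A| ^ k.-1 <= #|` diffset A A| ^ k)%N.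
  rewrite -(leq_pmul2r A_gt0) -mulnA -expnSr prednK //.
  by apply: leq_trans (plunnecke_ruzsa k _); rewrite -?cardfs_gt0 // leq_mul2r qk orbT.
move=> h; rewrite -mulnn expnM.
have h2 : ((q * #|` A| ^ k.-1) ^ k <= (#|` diffset A A| ^ k) ^ k)%N by rewrite leq_exp2r.
apply: leq_trans h2; rewrite expnMn -expnM.
have -> : (2 * k - 1 = k + k.-1)%N by lia.
rewrite expnD leq_mul2l; apply/orP; right; rewrite mulnC expnM.
by case: (k.-1) => // j; rewrite leq_exp2r.
Qed.

Lemma g_le k q (A : {fset int}) : (0 < k)%N ->
  contains_interval q (kfold k A) -> (g k q <= #|` diffset A A|)%N.
Proof. by move=> /(g_min q)[_ gmin] hA; apply: gmin; exists A. Qed.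

Lemma g_attained k q : (0 < k)%N ->
  exists2 A : {fset int}, contains_interval q (kfold k A) & #|` diffset A A| = g k q.
Proof. by move=> /(g_min q)[[A hA gA] _]; exists A. Qed.

Lemma pow_le_g k q : (0 < k)%N -> (0 < q)%N -> (q ^ (2 * k - 1) <= g k q ^ (k ^ 2))%N.
Proof.
by move=> k0 q0; have [A hA <-] := g_attained q k0; apply: pow_le_diffset.
Qed.

Lemma g_gt0 k q : (0 < k)%N -> (0 < q)%N -> (0 < g k q)%N.
Proof.
move=> k0 q0; have := pow_le_g k0 q0; case: (g k q) => // .
by rewrite exp0n ?expn_gt0 ?k0 // leqn0 expn_eq0; lia.
Qed.

Lemma contains_interval0 q (B : {fset int}) :
  (forall y : nat, (y < q)%N -> y%:Z \in B) -> contains_interval q B.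
Proof.
move=> h; exists (- 1) => -[|i] // /andP[_ iq].
by rewrite intS addrA addNr add0r; apply: h.
Qed.

Lemma g_pow_le k n : (0 < k)%N -> (g k (n ^ k) <= (n * k) ^ 2)%N.
Proof.
move=> k0.
pose A := [fset (x * n ^ j)%N%:Z | x in iota 0 n, j in iota 0 k]%fset.
have cardA : (#|` A| <= n * k)%N.
  have -> : (n * k)%N = size [seq (x * n ^ j)%N%:Z | x <- iota 0 n, j <- iota 0 k].
    by rewrite size_allpairs !size_iota.
  apply: card_fset_le => _ /imfset2P[x /= xn [j /= jk ->]].
  exact: (allpairs_f (fun x j => (x * n ^ j)%N%:Z)).
apply: (@leq_trans #|` diffset A A|).
  apply: g_le => //; apply: contains_interval0 => y /digits_exist[d dn ->].
  apply/kfoldP; exists (fun j => (d j * n ^ j)%N%:Z); last first.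
    by rewrite -natz natr_sum; apply: eq_bigr => i _; rewrite natz.
  move=> j; apply/imfset2P; exists (d j); first by rewrite /= mem_iota dn.
  by exists (val j); rewrite //= mem_iota ltn_ord.
by apply: leq_trans (card_diffset_le _ _) _; rewrite -mulnn leq_mul.
Qed.

(** * Lifting from vectors over ['F_p] to integers *)

Section Lift.
Variables (p : nat) (p_prime : prime p).

Lemma val_Fp_sum k (h : 'I_k -> 'F_p) : val (\sum_i h i) = ((\sum_i val (h i)) %% p)%N.
Proof.
rewrite -(val_Fp_nat p_prime) natr_sum; congr val.
by apply: eq_bigr => i _; rewrite natr_Zp.
Qed.

Lemma val_Fp_lt (x : 'F_p) : (val x < p)%N.
Proof. by rewrite -[X in (_ < X)%N](Fp_cast p_prime) ltn_ord. Qed.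

(** [b] records the borrow of the subtraction modulo [p]. *)
Lemma val_FpB (x y : 'F_p) : exists b : bool, (val x + b * p = val y + val (x - y)%R)%N.
Proof.
have : val x = ((val y + val (x - y)%R) %% p)%N.
  by rewrite -(val_Fp_nat p_prime) natrD !natr_Zp addrC subrK.
have := val_Fp_lt y; have := val_Fp_lt (x - y).
move: (val y) (val (x - y)) => u v vp up ->.
have [uv|uv] := ltnP (u + v) p; first by exists false; rewrite modn_small ?addn0.
by exists true; rewrite -[in LHS](subnK uv) modnDr modn_small ?subnK //; lia.
Qed.

(** The coordinates are read as base-[p] digits; the terms [p * e i] are corrections that cancel
    carries. *)
Definition lift_Fp n (x : 'rV['F_p]_n) (e : 'I_n -> int) : int :=
  \sum_i ((val (x ord0 i))%:Z + p%:Z * e i) * p%:Z ^+ i.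

Lemma exists_lift n k (B : {set 'rV['F_p]_n}) : nsums k.+1 B = [set: 'rV['F_p]_n] ->
  exists2 A : {fset int}, contains_interval (p ^ n) (kfold k.+1 A) &
    (#|` diffset A A| <= #|dset B| * (k.+1 + k.+1) ^ n)%N.
Proof.
move=> BF.
pose lift1 (x : 'rV['F_p]_n * {ffun 'I_n -> 'I_k.+1}) :=
  lift_Fp x.1 (fun i => - (val (x.2 i))%:Z).
pose A := [fset lift1 x | x in enum (finset.setX B [set: {ffun 'I_n -> 'I_k.+1}])]%fset.
have memA x (c : {ffun 'I_n -> 'I_k.+1}) : x \in B ->
    lift_Fp x (fun i => - (val (c i))%:Z) \in A.
  by move=> xB; apply/imfsetP; exists (x, c) => //=; rewrite mem_enum !inE xB.
exists A.
  apply: contains_interval0 => y /digits_exist[d dp ->].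
  have : \row_i (inZp (d i) : 'F_p) \in nsums k.+1 B by rewrite BF inE.
  case/nsumsP => h hB hd.
  have hc i : ((\sum_j val (h j ord0 i)) %/ p < k.+1)%N.
    rewrite ltn_divLR ?prime_gt0 //.
    apply: (@leq_trans (\sum_j (val (h j ord0 i)).+1)%N).
      under [leqRHS]eq_bigr => j _ do rewrite -addn1.
      by rewrite big_split /= sum1_card card_ord addnS ltnS leq_addr.
    apply: (@leq_trans (\sum_(j < k.+1) p)%N); last by rewrite sum_nat_const card_ord.
    by apply: leq_sum => j _; apply: val_Fp_lt.
  have hm i : ((\sum_j val (h j ord0 i)) %% p = d i)%N.
    have := congr1 (fun M : 'rV_n => val (M ord0 i)) hd.
    rewrite summxE val_Fp_sum => <-; rewrite mxE /=; apply: modn_small.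
    by rewrite (Fp_cast p_prime).
  (* In coordinate [i] the representatives add up to [d i] plus a carry, at most [k], times [p]. The
     summand [ord0] absorbs the whole carry. *)
  pose c (j : 'I_k.+1) : {ffun 'I_n -> 'I_k.+1} :=
    if j == ord0 then [ffun i => Ordinal (hc i)] else [ffun=> ord0].
  apply/kfoldP; exists (fun j => lift_Fp (h j) (fun i => - (val (c j i))%:Z)).
    by move=> j; apply: memA.
  rewrite /lift_Fp exchange_big /= -natz natr_sum; apply: eq_bigr => i _.
  rewrite -mulr_suml natrM natrX !natz; congr (_ * _).
  rewrite big_split /= -mulr_sumr sumrN -hm.
  have -> : \sum_(j < k.+1) (val (c j i))%:Z = ((\sum_j val (h j ord0 i)) %/ p)%:Z.
    rewrite (bigD1 ord0) //= big1 => [|j /negPf j0]; last by rewrite /c j0 ffunE.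
    by rewrite addr0 /c eqxx ffunE.
  have -> : \sum_(j < k.+1) (val (h j ord0 i))%:Z = (\sum_j val (h j ord0 i))%N%:Z.
    by rewrite -natz natr_sum; apply: eq_bigr => j _; rewrite natz.
  move: (\sum_j val _)%N => S.
  have : S%:Z = ((S %/ p) * p + S %% p)%N%:Z by rewrite -divn_eq.
  by rewrite PoszD PoszM => ->; ring.
(* The correction of a difference is [c' - c - b] with a borrow [b], which lies between [-(k + 1)]
   and [k]; shifted by [k + 1] it becomes an element of ['I_(k.+1 + k.+1)]. *)
pose lift2 (x : 'rV['F_p]_n) (u : {ffun 'I_n -> 'I_(k.+1 + k.+1)}) :=
  lift_Fp x (fun i => (val (u i))%:Z - k.+1%:Z).
pose s := [seq lift2 x u |
  x <- enum (dset B), u <- enum {: {ffun 'I_n -> 'I_(k.+1 + k.+1)}}].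
have -> : (#|dset B| * (k.+1 + k.+1) ^ n)%N = size s.
  by rewrite size_allpairs -!cardE card_ffun !card_ord.
apply: card_fset_le => _ /diffsetP[_ [_ [/imfsetP[[x c] /= xB ->] /imfsetP[[x' c'] /= x'B ->] ->]]].
move: xB x'B; rewrite !mem_enum !inE !andbT /= => xB x'B.
have ex i : exists u : 'I_(k.+1 + k.+1),
    (val (x ord0 i))%:Z - p%:Z * (val (c i))%:Z - ((val (x' ord0 i))%:Z - p%:Z * (val (c' i))%:Z) ==
    (val ((x - x') ord0 i))%:Z + p%:Z * ((val u)%:Z - k.+1%:Z).
  have [b hb] := val_FpB (x ord0 i) (x' ord0 i).
  have ci := ltn_ord (c i); have c'i := ltn_ord (c' i).
  have bnd : (k.+1 + c' i - c i - b < k.+1 + k.+1)%N by lia.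
  exists (Ordinal bnd); rewrite /= !mxE.
  have -> : (k.+1 + c' i - c i - b)%N%:Z = k.+1%:Z + (c' i)%:Z - (c i)%:Z - b%:Z.
    by case: (b); lia.
  have hbZ : (val (x ord0 i))%:Z + b%:Z * p%:Z =
      (val (x' ord0 i))%:Z + (val (x ord0 i - x' ord0 i))%:Z.
    by rewrite -PoszM -!PoszD hb.
  rewrite -[(val (x ord0 i))%:Z](addrK (b%:Z * p%:Z)) hbZ /=; apply/eqP.
  by ring.
have -> : lift_Fp x (fun i => - (val (c i))%:Z) - lift_Fp x' (fun i => - (val (c' i))%:Z) =
    lift2 (x - x') [ffun i => xchoose (ex i)].
  rewrite /lift2 /lift_Fp -sumrB; apply: eq_bigr => i _; rewrite -mulrBl; congr (_ * _).
  by rewrite ffunE -(eqP (xchooseP (ex i))) !mulrN.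
apply: allpairs_f.
  by rewrite mem_enum mem_dset.
by rewrite mem_enum.
Qed.

End Lift.

Lemma g_pow_le_g k p t q n : prime p -> (p <= q ^ n)%N -> (p ^ k.+1 < 2 ^ t)%N ->
  (g k.+1 (p ^ k.+1) <=
     t.+1 ^ 2 * (k.+1 + k.+1) ^ k.+1 * g k.+2 q ^ (n * k.+2))%N.
Proof.
move=> p_prime pq pt; have [A hA <-] := g_attained q (isT : 0 < k.+2)%N.
have [An hAn cardAn] := contains_interval_pow n hA.
have Fp_t : (#|'F_p| ^ k.+1 < 2 ^ t)%N by rewrite card_Fp.
have [B hB cardB] := covering_set_in_smaller_dimension (nsums_modp p_prime pq hAn) Fp_t.
have [A' hA' cardA'] := exists_lift p_prime hB.
apply: leq_trans (g_le _ hA') _ => //; apply: leq_trans cardA' _.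
rewrite mulnAC leq_mul //; apply: leq_trans cardB _.
rewrite leq_mul // expnM leq_exp2r //.
exact: leq_trans (dset_modp p An) cardAn.
Qed.

(** * Passage to logarithms and [beta] *)

Section Beta.
Variable R : realType.
Local Notation ln := (@ln R).

Lemma ln_nat_ge0 (n : nat) : 0 <= ln n%:R.
Proof. by case: n => [|n]; [rewrite ln0|apply: ln_ge0; rewrite ler1n]. Qed.

Lemma ln_nat_gt0 (n : nat) : (1 < n)%N -> 0 < ln n%:R.
Proof. by move=> n1; apply: ln_gt0; rewrite ltr1n. Qed.

Lemma ler_ln_nat (m n : nat) : (0 < m)%N -> (m <= n)%N -> ln m%:R <= ln n%:R.
Proof. by move=> m0 mn; rewrite ler_ln ?posrE ?ltr0n ?ler_nat //; apply: leq_trans mn. Qed.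

Lemma ln_natX (m n : nat) : (0 < m)%N -> ln (m ^ n)%:R = n%:R * ln m%:R.
Proof. by move=> m0; rewrite natrX lnXn ?ltr0n // mulr_natl. Qed.

Lemma ln_natM (m n : nat) : (0 < m)%N -> (0 < n)%N ->
  ln (m * n)%:R = ln m%:R + ln n%:R.
Proof. by move=> m0 n0; rewrite natrM lnM ?posrE ?ltr0n. Qed.

Lemma beta_mul_le k q : (2 <= q)%N -> beta R k * ln q%:R <= ln (g k q)%:R.
Proof.
move=> q2; rewrite -ler_pdivlMr ?ln_nat_gt0 //; apply: ge_inf; last by exists q.
by exists 0 => _ [r _ <-]; rewrite divr_ge0 ?ln_nat_ge0.
Qed.

Lemma le_beta k c : (forall q, (2 <= q)%N -> c * ln q%:R <= ln (g k q)%:R) ->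
  c <= beta R k.
Proof.
move=> h; apply: lb_le_inf; first by exists (ln (g k 2)%:R / ln 2%:R), 2%N.
by move=> _ [q q2 <-]; rewrite ler_pdivlMr ?ln_nat_gt0 // h.
Qed.

(** Replaces division by [r] and a limit: if [a > b], every such [r] would be at most
    [c / (a - b)]. *)
Lemma le_of_unbounded (a b c : R) :
  (forall N : nat, exists2 r : nat, (N <= r)%N & a * r%:R <= b * r%:R + c) -> a <= b.
Proof.
move=> h; rewrite leNgt; apply/negP => ab; have ab0 : 0 < a - b by rewrite subr_gt0.
have [r + abr] := h (Num.truncn (c / (a - b))).+1.
rewrite -(ler_nat R) => /(lt_le_trans (truncnS_gt _)).
by rewrite ltr_pdivrMr // mulrBr => hr; nra.
Qed.

Lemma beta_ge k : (0 < k)%N -> 2 / k%:R - 1 / k%:R ^+ 2 <= beta R k.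
Proof.
move=> k0; apply: le_beta => q q2.
have kR : k%:R != 0 :> R by rewrite pnatr_eq0 -lt0n.
have k2 : 0 < k%:R ^+ 2 :> R by rewrite exprn_gt0 ?ltr0n.
have q0 : (0 < q)%N by lia.
have -> : 2 / k%:R - 1 / k%:R ^+ 2 = (2 * k - 1)%N%:R / k%:R ^+ 2 :> R.
  by rewrite natrB ?natrM; [field|lia].
rewrite mulrAC ler_pdivrMr // -ln_natX // mulrC -natrX -ln_natX ?g_gt0 //.
by rewrite ler_ln_nat ?expn_gt0 ?q0 // pow_le_g.
Qed.

Lemma beta_le k : (0 < k)%N -> beta R k <= 2 / k%:R.
Proof.
move=> k0; rewrite ler_pdivlMr ?ltr0n //.
apply: (@le_of_unbounded _ _ 2) => N; exists N.+1 => //.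
(* With base [n = (k + 1) ^ m], [ln n] is [m] times [ln (k + 1)], while the extra [ln k] is at most
   [ln (k + 1)]; dividing by the latter leaves the constant 2. *)
set m := N.+1; pose n := (k.+1 ^ m)%N; have n0 : (0 < n)%N by rewrite expn_gt0.
have n1 : (1 < n)%N by rewrite -(exp1n m) ltn_exp2r // ltnS.
have nk2 : (2 <= n ^ k)%N by rewrite -(exp1n k) ltn_exp2r.
have := beta_mul_le k nk2; have := ler_ln_nat (g_gt0 k0 (ltnW nk2)) (g_pow_le n k0).
rewrite !ln_natX ?muln_gt0 ?n0 ?k0 // ln_natM // ln_natX //.
have := ler_ln_nat k0 (leqnSn k); have : 0 < ln k.+1%:R by rewrite ln_nat_gt0 ?ltnS.
move: (ln _) (ln k%:R) => L l L0 lL h1 h2.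
rewrite -(ler_pM2r L0); have := le_trans h2 h1; nra.
Qed.

(* A prime [p] between [2 ^ (r ^ 2)] and [2 ^ ((r + 1) ^ 2)] makes the factor
   [t ^ 2] of [g_pow_le_g] only polynomial in [r], hence negligible against
   [ln p >= r ^ 2 * ln 2]. *)
Lemma beta_step k : (0 < k)%N -> k%:R * beta R k <= k.+1%:R * beta R k.+1.
Proof.
case: k => // k _; rewrite -ler_pdivrMl ?ltr0n //; apply: le_beta => q q2.
have lq : 0 < ln q%:R by apply: ln_nat_gt0.
have D0 : (0 < g k.+2 q)%N by apply: g_gt0 => //; lia.
set x := k.+1%:R * beta R k.+1; set lD := ln (g k.+2 q)%:R.
pose y := k.+2%:R * (lD / ln q%:R).
rewrite -ler_pdivlMr // ler_pdivrMl ?ltr0n // -/y leNgt; apply/negP => yx.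
have l2 : 0 < ln 2%:R by apply: ln_nat_gt0.
have y0 : 0 <= y by rewrite mulr_ge0 // divr_ge0 ?ln_nat_ge0.
(* The terms of the estimate independent of [p]: from [t.+1 <= k.+2 * r.+1 ^ 2], from the lifting
   factor, and from rounding [n] up. *)
pose c := 2 * ln k.+2%:R + k.+1%:R * ln (k.+1 + k.+1)%:R + y * ln q%:R.
have c0 : 0 <= c by rewrite /c !addr_ge0 // mulr_ge0 ?ln_nat_ge0.
suff : (x - y) * ln 2%:R <= 0.
  by rewrite leNgt => /negP[]; rewrite mulr_gt0 // subr_gt0.
(* The final bound is [(x - y) * r ^ 2 * ln 2 <= c + 4 * (r + 1)]; for [r >= 1] its right side is at
   most [(c + 8) * r], and one factor [r] cancels. *)
apply: (@le_of_unbounded _ _ (c + 8)) => N.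
have [p Np p_prime] := prime_above (2 ^ (N.+1 ^ 2)).
have p1 := prime_gt1 p_prime; have p0 := prime_gt0 p_prime.
have ex_s : exists s, (p < 2 ^ (s ^ 2))%N.
  exists p; apply: leq_trans (ltn_expl p (isT : 1 < 2)%N) _.
  by rewrite leq_exp2l // -mulnn leq_pmulr.
case: (ex_minnP ex_s) => -[|r]; first by rewrite ltnNge p0.
move=> pr rmin.
have rp : (2 ^ (r ^ 2) <= p)%N.
  by rewrite leqNgt; apply/negP => /rmin; rewrite ltnn.
have Nr : (N.+1 <= r)%N.
  rewrite leqNgt; apply/negP => rN; have := leq_trans Np (ltnW pr).
  by apply/negP; rewrite -leqNgt leq_exp2l // leq_exp2r.
have lpr : r%:R ^+ 2 * ln 2%:R <= ln p%:R.
  by rewrite -natrX -ln_natX // ler_ln_nat ?expn_gt0.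
(* The least [n] with [p <= q ^ n] overshoots by less than a factor [q], so [n * ln q] exceeds
   [ln p] by at most [ln q]. *)
pose n := up_log q p.
have [qn pq] : (q ^ n.-1 < p)%N /\ (p <= q ^ n)%N by apply/andP/up_log_bounds.
have n_gt0 : (0 < n)%N by rewrite up_log_gt0 ?p1 ?q2.
have lqn : n%:R * ln q%:R <= ln p%:R + ln q%:R.
  rewrite -(prednK n_gt0) -addn1 natrD mulrDl mul1r lerD2r -ln_natX; last by lia.
  by rewrite ler_ln_nat ?expn_gt0; lia.
pose t := (k.+1 * r.+1 ^ 2)%N.
have pt : (p ^ k.+1 < 2 ^ t)%N by rewrite /t mulnC expnM ltn_exp2r.
have lt : ln t.+1%:R <= ln k.+2%:R + 2 * r.+1%:R.
  apply: (@le_trans _ _ (ln (k.+2 * r.+1 ^ 2)%:R)).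
    by rewrite ler_ln_nat // /t [leqRHS]mulSn -add1n leq_add2r expn_gt0.
  rewrite ln_natM ?expn_gt0 // ln_natX // lerD2l ler_wpM2l //.
  by apply/ltW/ln_sublinear; rewrite ltr0n.
have pk2 : (2 <= p ^ k.+1)%N by rewrite -(exp1n k.+1) ltn_exp2r.
have := beta_mul_le k.+1 pk2.
have := ler_ln_nat (g_gt0 (isT : 0 < k.+1)%N (ltnW pk2)) (g_pow_le_g p_prime pq pt).
rewrite !ln_natM ?muln_gt0 ?expn_gt0 ?D0 ?orbT // !ln_natX //.
have -> : (n * k.+2)%:R * ln (g k.+2 q)%:R = y * (n%:R * ln q%:R).
  by rewrite natrM /y -/lD; field; rewrite gt_eqF.
move=> h1 h2; have := le_trans h2 h1.
rewrite mulrA [_ * k.+1%:R]mulrC -/x => h.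
have h3 := ler_wpM2l y0 lqn.
have h4 : (x - y) * ln p%:R <= c + 4 * r.+1%:R.
  by rewrite /c; nra.
exists r; first exact: ltnW.
have r1 : 1 <= r%:R :> R by rewrite ler1n; apply: leq_trans Nr.
have h5 : (x - y) * (r%:R ^+ 2 * ln 2%:R) <= c + 4 * r.+1%:R.
  by apply: le_trans h4; rewrite ler_pM2l ?subr_gt0.
rewrite -(ler_pM2r (lt_le_trans ltr01 r1)) mul0r add0r.
have cr : c <= c * r%:R by rewrite ler_peMr.
have -> : (x - y) * ln 2%:R * r%:R * r%:R = (x - y) * (r%:R ^+ 2 * ln 2%:R) by ring.
by move: h5; rewrite -natr1; lra.
Qed.

Lemma mulr_beta_mono k l : (0 < k)%N -> (k <= l)%N ->
  k%:R * beta R k <= l%:R * beta R l.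
Proof.
move=> k0; elim: l => [|l IH]; first by rewrite leqn0 => /eqP ->.
rewrite leq_eqVlt => /orP[/eqP ->//|]; rewrite ltnS => kl.
by apply: le_trans (IH kl) (beta_step _); apply: leq_trans kl.
Qed.

End Beta.

Theorem theorem4 (R : realType) :
  (forall k : nat, (0 < k)%N ->
     2 / k%:R - 1 / k%:R ^+ 2 <= beta R k /\ beta R k <= 2 / k%:R) /\
  (forall k l : nat, (0 < k)%N -> (k <= l)%N ->
     k%:R * beta R k <= l%:R * beta R l).
Proof.
split=> [k k0|k l]; first by split; [apply: beta_ge|apply: beta_le].
exact: mulr_beta_mono.
Qed.
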